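(* Suppose $w$ is nonnegative and symmetric, let $x_t(\alpha)$ be a solution (in the sense of the context) of $$\dot{x}_t(\alpha) = \int_{0}^{1} w(t,\alpha,\beta,x_t(\alpha),x_t(\beta))\,(x_t(\beta)-x_t(\alpha))\,d\beta,$$ and let $\mu_t(A)=\mathcal{L}(\{\alpha\in[0,1] : x_t(\alpha)\in A\})$ for Borel sets $A\subseteq\mathbb{R}$. Then there exists a measure $\mu_\infty$ on $[0,1]$ such that $\mu_t$ approaches $\mu_\infty$ in distribution as $t\to\infty$.
   Context: $\mathcal{L}$ denotes Lebesgue measure. The weight function $w:[0,\infty)\times[0,1]\times[0,1]\times\mathbb{R}\times\mathbb{R}\to[0,\infty)$ is jointly measurable in all its variables and bounded: $w\le W$ for some constant $W<\infty$. Symmetric means $w(t,\alpha,\beta,x_t(\alpha),x_t(\beta))=w(t,\beta,\alpha,x_t(\beta),x_t(\alpha))$ for all $t,\alpha,\beta$. A solution is a function $(t,\alpha)\mapsto x_t(\alpha)$ from $[0,\infty)\times[0,1]$ to $\mathbb{R}$ such that: $x_t(\cdot)$ is measurable for each $t$; for each $\alpha\in[0,1]$, $t\mapsto x_t(\alpha)$ is absolutely continuous (on bounded intervals) and the equation holds for almost all $t$; $x_0(\alpha)\in[0,1]$ for all $\alpha$; and $\sup_{\alpha\in[0,1],\,t\le T}|x_t(\alpha)|<\infty$ for every $T\ge 0$. Convergence in distribution: $\mu_t$ approaches $\mu_\infty$ in distribution if $\lim_{t\to\infty}\mu_t(A)=\mu_\infty(A)$ for all Borel sets $A$ whose boundary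 has $\mu_\infty$-measure $0$; equivalently, $\lim_{t\to\infty}\int\eta\,d\mu_t=\int\eta\,d\mu_\infty$ for every bounded continuous function $\eta$ (a measure on $[0,1]$ is viewed as a measure on $\mathbb{R}$ supported in $[0,1]$). *)

(* Defs.v *)
From HB Require Import structures.
From mathcomp Require Import all_boot all_order all_algebra.
From mathcomp Require Import all_classical all_reals all_analysis.
Set Implicit Arguments.
Unset Strict Implicit.
Unset Printing Implicit Defensive.
Import Order.TTheory GRing.Theory Num.Theory.
Import numFieldNormedType.Exports.
Local Open Scope classical_set_scope.
Local Open Scope ring_scope.

(* Weights and trajectories are total functions on R; only their values on
   [0, +oo[ (time) and [0, 1] (agents) are constrained or used.
   Measurability is with respect to the Borel sigma-algebra of R and its
   products, the sigma-algebra carried by lebesgue_measure. *)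

Definition weight_domain (R : realType) : set (R * R * R * R * R) :=
  `[0, +oo[ `*` `[0, 1] `*` `[0, 1] `*` [set: R] `*` [set: R].

Definition weight_measurable (R : realType) (w : R -> R -> R -> R -> R -> R) :=
  measurable_fun (@weight_domain R)
    (fun p : R * R * R * R * R =>
       w p.1.1.1.1 p.1.1.1.2 p.1.1.2 p.1.2 p.2).

Definition weight_nonneg (R : realType) (w : R -> R -> R -> R -> R -> R) :=
  forall t a b y z : R, 0 <= t -> a \in `[0, 1] -> b \in `[0, 1] ->
    0 <= w t a b y z.

Definition weight_bounded (R : realType) (w : R -> R -> R -> R -> R -> R) :=
  exists W : R, forall t a b y z : R,
    0 <= t -> a \in `[0, 1] -> b \in `[0, 1] -> w t a b y z <= W.

(* Symmetry is only required along the given trajectory x. *)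
Definition weight_symmetric (R : realType) (w : R -> R -> R -> R -> R -> R)
    (x : R -> R -> R) :=
  forall t a b : R, 0 <= t -> a \in `[0, 1] -> b \in `[0, 1] ->
    w t a b (x t a) (x t b) = w t b a (x t b) (x t a).

Definition abs_continuous (R : realType) (a b : R) (f : R -> R) :=
  forall e : R, 0 < e -> exists2 d : R, 0 < d &
    forall (n : nat) (u v : 'I_n -> R),
      (forall i, a <= u i /\ u i <= v i /\ v i <= b) ->
      trivIset [set: 'I_n] (fun i => [set` `]u i, v i[]) ->
      \sum_(i < n) (v i - u i) < d ->
      \sum_(i < n) `|f (v i) - f (u i)| < e.

Record is_solution (R : realType) (w : R -> R -> R -> R -> R -> R)
    (x : R -> R -> R) : Prop := IsSolution {
  solution_measurable : forall t : R, 0 <= t ->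
    measurable_fun (`[0, 1] : set R) (x t);
  solution_abs_continuous : forall a : R, a \in `[0, 1] ->
    forall T : R, 0 <= T -> abs_continuous 0 T (fun t => x t a);
  (* t = 0 is a null set, so two-sided derivatives at t > 0 suffice. *)
  solution_ode : forall a : R, a \in `[0, 1] ->
    {ae @lebesgue_measure R, forall t : R, 0 < t ->
      is_derive t (1 : R) (fun s => x s a)
        (\int[lebesgue_measure]_(b in `[0, 1])
           (w t a b (x t a) (x t b) * (x t b - x t a)))};
  solution_init : forall a : R, a \in `[0, 1] -> x 0 a \in `[0, 1];
  solution_bounded : forall T : R, 0 <= T ->
    has_ubound [set r : R | exists t a : R,
      [/\ t \in `[0, T], a \in `[0, 1] & r = `|x t a|]]
}.

Definition opinion_distribution (R : realType) (x : R -> R -> R) (t : R)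
    (A : set R) : \bar R :=
  lebesgue_measure [set a : R | a \in `[0, 1] /\ A (x t a)].

Definition boundary (T : topologicalType) (A : set T) : set T :=
  closure A `\` interior A.

Definition converges_in_distribution (R : realType) (mu : R -> set R -> \bar R)
    (mu_oo : set R -> \bar R) :=
  forall A : set R, measurable A -> mu_oo (boundary A) = 0%E ->
    mu t A @[t --> +oo] --> mu_oo A.

(* Main.v *)
(* For a convex f with derivative f', symmetry of w gives
     d/dt int f(x_t) = - 1/2 int int w (f'(x_t(b)) - f'(x_t(a))) (x_t(b) - x_t(a)) <= 0,
   which is justified in integrated form by the fundamental theorem of calculus
   for absolutely continuous functions and Fubini's theorem. With f(x) = (-x)_+^2
   and f(x) = (x - 1)_+^2 this confines x_t to [0, 1] almost everywhere, and with
   f(x) = (c - x)_+^2 it shows that int (c - x_t)_+^2 converges for every c. Second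
   differences in c yield cutoffs between half-lines whose integrals converge, hence
   the quantile functions of mu_t converge outside a countable set; the limit law is
   the image of the uniform law by the limit of the quantile functions. *)
Require Import Defs.
From HB Require Import structures.
From mathcomp Require Import all_boot all_order all_algebra.
From mathcomp Require Import all_classical all_reals all_analysis.
From mathcomp Require Import measurable_realfun ring lra.
Import Order.TTheory GRing.Theory Num.Theory.
Import numFieldNormedType.Exports.
Local Open Scope classical_set_scope.
Local Open Scope ring_scope.

Set Implicit Arguments.
Unset Strict Implicit.

(** * Absolutely continuous functions *)

(** The null set of times where the equation fails depends on the agent, so the mean of f(x_t)
    cannot be differentiated at a given time: each path is integrated in time first, and only then
    are agents averaged and integrals exchanged. The exchange needs joint measurability in time and
    agent, which a solution does not assume; it comes from measurability in the agent and continuity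
    in time. The square in (c - x)_+^2 is there because the chain rule is applied with an f
    differentiable everywhere, which (c - x)_+ is not. Its second derivative in c is twice the
    indicator of x < c, so second differences in c see a smoothed distribution function. The
    smoothed integrals need not be monotone in time; they converge as linear combinations of
    monotone ones. *)

Section controlled_decrease.
Context {R : realType} (U : set R) (f : R -> R) (e a : R).

(* [U] will be a small open set covering the points where the derivative of [f]
   may fail to exist: the decrease of [f] on [a, t] is charged to finitely many
   disjoint intervals inside [U], and to a slope [- e] elsewhere. *)
Definition controlled_decrease (t : R) :=
  exists n (u v : 'I_n -> R),
  [/\ forall i, [/\ a <= u i, u i <= v i & v i <= t],
      forall i, `]u i, v i[ `<=` U,
      trivIset [set: 'I_n] (fun i => [set` `]u i, v i[]) &
      f a - f t <= e * (t - a) + \sum_(i < n) `|f (v i) - f (u i)| ].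

Lemma controlled_decrease_start : controlled_decrease a.
Proof.
exists 0%N, (fun=> a), (fun=> a); split.
- by case.
- by case.
- by case.
- by rewrite big_ord0 !subrr mulr0 addr0.
Qed.

Lemma controlled_decrease_slope s t : s <= t -> f s - f t <= e * (t - s) ->
  controlled_decrease s -> controlled_decrease t.
Proof.
move=> st fst [n [u [v [uv uvU duv H]]]]; exists n, u, v; split => //.
  by move=> i; have [au uvi vs] := uv i; split => //; exact: le_trans st.
lra.
Qed.

(** The earlier intervals end by [s], so []s, t[] can be appended without losing disjointness. Its
    term pays for the whole decrease on [[s, t]], and the slope allowance only grows since
    [0 <= e]. *)
Lemma controlled_decrease_cover s t : 0 <= e -> a <= s -> s <= t -> `]s, t[ `<=` U ->
  controlled_decrease s -> controlled_decrease t.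
Proof.
move=> e0 as_ st stU [n [u [v [uv uvU duv H]]]].
exists n.+1, (fun i => oapp u s (unlift ord_max i)),
  (fun i => oapp v t (unlift ord_max i)); split.
- move=> i; case: unliftP => [j|] _ /=; last by split.
  by have [? ? vs] := uv j; split => //; exact: le_trans st.
- by move=> i; case: unliftP => [j|] _ /=.
- move=> i j _ _ /=; case: unliftP => [i'|] ->; case: unliftP => [j'|] -> //=.
  + by move=> h; rewrite (duv i' j' I I h).
  + move=> [x [/=]]; rewrite !in_itv/= => /andP[_ xv] /andP[sx _].
    by have [_ _ /(lt_le_trans xv)/(lt_trans sx)] := uv i'; rewrite ltxx.
  + move=> [x [/=]]; rewrite !in_itv/= => /andP[sx _] /andP[_ xv].
    by have [_ _ /(lt_le_trans xv)/(lt_trans sx)] := uv j'; rewrite ltxx.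
- rewrite big_ord_recr/= unlift_none/=.
  under eq_bigr => i _.
    rewrite (_ : widen_ord (leqnSn n) i = lift ord_max i); last first.
      by apply: val_inj; rewrite /= /bump leqNgt ltn_ord.
    rewrite liftK/=; over.
  move=> /=.
  have : f s - f t <= `|f t - f s| by rewrite distrC ler_norm.
  have : e * (s - a) <= e * (t - a) by rewrite ler_wpM2l// lerB.
  lra.
Qed.

End controlled_decrease.

Lemma sum_itv_le_measure {R : realType} (U : set R) n (u v : 'I_n -> R) :
  measurable U -> (forall i, u i <= v i) -> (forall i, `]u i, v i[ `<=` U) ->
  trivIset [set: 'I_n] (fun i => [set` `]u i, v i[]) ->
  ((\sum_(i < n) (v i - u i))%:E <= lebesgue_measure U)%E.
Proof.
move=> mU uv uvU duv.
rewrite -sumEFin (eq_bigr (fun i => lebesgue_measure [set` `]u i, v i[])); last first.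
  move=> i _; rewrite lebesgue_measure_itv/= lte_fin.
  have := uv i; rewrite le_eqVlt => /predU1P[->|->//].
  by rewrite ltxx subrr.
rewrite -(measure_bigsetU_ord _ xpredT)//.
apply: le_measure; rewrite ?inE//; first exact: bigsetU_measurable.
by elim/big_ind : _ => // A B AU BU; rewrite subUset.
Qed.

(** The supremum of the points of [[a, b]] where [P] holds satisfies [P] by the left half of the
    local hypothesis, and cannot lie below [b] by the right half. *)
Lemma real_induction {R : realType} (P : R -> Prop) (a b : R) : a <= b -> P a ->
  (forall c, a <= c -> c <= b -> exists2 d, 0 < d &
     (forall s, a <= s -> s <= c -> c - d < s -> P s -> P c) /\
     (forall t, c <= t -> t < c + d -> P c -> P t)) ->
  P b.
Proof.
move=> ab Pa step; pose S := [set t | [/\ a <= t, t <= b & P t]].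
have Sa : S a by [].
have ubS : has_ubound S by exists b => t [].
have supS : has_sup S by split; first by exists a.
have ac : a <= sup S by exact: ub_le_sup.
have cb : sup S <= b by apply: ge_sup; [exists a|move=> t []].
have [d d0 [left right]] := step _ ac cb.
have [s [as_ sb Ps] dsS] := sup_adherent d0 supS.
have Pc : P (sup S).
  by apply: (left s) => //; apply: ub_le_sup.
move: cb; rewrite le_eqVlt => /predU1P[<-//|cb].
pose t := Num.min b (sup S + d / 2).
have ct : sup S < t by rewrite lt_min cb ltrDl divr_gt0.
suff: t <= sup S by rewrite leNgt ct.
apply: ub_le_sup => //; split.
- by rewrite (le_trans ac)// ltW.
- by rewrite ge_min lexx.
- apply: right => //; first exact: ltW.
  by rewrite gt_min ltrD2l ltr_pdivrMr// mulr_natr mulr2n ltrDl d0 orbT.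
Qed.

(** Difference quotients near [t] exceed [- e]; multiplying by [s - t] bounds the decrease on either
    side of [t]. *)
Lemma is_derive_ge0_slope {R : realType} (f : R -> R) (t l e : R) :
  is_derive t 1 f l -> 0 <= l -> 0 < e ->
  exists2 d, 0 < d & forall s, `|s - t| < d ->
    (s <= t -> f s - f t <= e * (t - s)) /\ (t <= s -> f t - f s <= e * (s - t)).
Proof.
move=> [df <-] l0 e0.
have : (fun h => h^-1 *: ((f \o shift t) (h *: 1) - f t)) @ 0^' --> 'D_1 f t by exact: df.
move=> /cvgrPdist_lt/(_ _ e0) [d /= d0 H]; exists d => // s std.
have [->|st] := eqVneq s t; first by rewrite !subrr mulr0.
have := H (s - t).
rewrite /ball_/= sub0r normrN => /(_ std); rewrite subr_eq0 => /(_ st).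
rewrite [(s - t) *: 1]mulr1 subrK => /(le_lt_trans (ler_norm _)).
set q := _ *: _ => ql.
have E : f s - f t = (s - t) * q.
  by rewrite [q](_ : _ = (s - t)^-1 * (f s - f t))// mulVKf// subr_eq0.
split => h; nra.
Qed.

(* The endpoints are added to the null set [N], so that every point of [a, b]
   is either in the open cover [U] or a point with nonnegative derivative. *)
Lemma abs_continuous_nondecreasing {R : realType} (a b : R) (f : R -> R) :
  a <= b -> abs_continuous a b f ->
  {ae @lebesgue_measure R, forall t, a < t < b -> exists2 l, 0 <= l & is_derive t 1 f l} ->
  f a <= f b.
Proof.
move=> ab acf [N [mN N0 subN]].
apply/ler_addgt0Pr => e0 e0_gt0.
(* The slope part will cost [e * (b - a)] and the intervals inside [U] less than [e], which adds up
   to [e0]. *)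
pose e := e0 / (b - a + 1).
have e_gt0 : 0 < e by rewrite divr_gt0// ltr_wpDl// subr_ge0.
have [d d_gt0 acfd] := acf _ e_gt0.
pose N' := N `|` [set a] `|` [set b].
have mN' : measurable N' by apply: measurableU => //; exact: measurableU.
have N'0 : lebesgue_measure N' = 0%E.
  have ? : measurable (N `|` [set a]) by exact: measurableU.
  have Na0 : lebesgue_measure (N `|` [set a]) = 0%E.
    by apply: null_set_setU => //; exact: lebesgue_measure_set1.
  by apply: null_set_setU => //; exact: lebesgue_measure_set1.
have [|U [oU N'U Ud]] := lebesgue_regularity_outer mN' _ d_gt0.
  by rewrite [X in (X < _)%E]N'0.
have mU : measurable U by exact: open_measurable.
(* Outer regularity bounds [U] minus [N']; as [N'] is null, it bounds [U] too. *)
have {}Ud : (lebesgue_measure U < d%:E)%E.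
  rewrite -(setDKU N'U) (le_lt_trans (measureU2 _ _ _))//; first exact: measurableD.
  by rewrite [X in (_ + X)%E]N'0 adde0.
have : controlled_decrease U f e a b.
  apply: real_induction ab (controlled_decrease_start _ _ _ _) _ => c ac cb.
  have [Uc|NUc] := pselect (U c).
    have /nbhs_ballP[r /= r0 rU] : nbhs c U by exact: open_nbhs_nbhs.
    exists r => //; split.
      move=> s as_ sc crs; apply: controlled_decrease_cover => //; first exact: ltW.
      move=> x /=; rewrite in_itv/= => /andP[sx xc].
      by apply: rU; rewrite /ball/= ltr_distl; lra.
    move=> t ct tcr; apply: controlled_decrease_cover => //; first exact: ltW.
    move=> x /=; rewrite in_itv/= => /andP[cx xt].
    by apply: rU; rewrite /ball/= ltr_distl; lra.
  have NN'c : ~ N' c by move=> /N'U.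
  have acb : a < c < b.
    rewrite !lt_neqAle ac cb !andbT; apply/andP; split; apply/eqP => E.
      by apply: NN'c; left; right.
    by apply: NN'c; right.
  have [l l0 dl] : exists2 l, 0 <= l & is_derive c 1 f l.
    apply: contrapT => H; apply: NN'c; left; left; apply: subN => /= /(_ acb) //.
  have [r r0 slope] := is_derive_ge0_slope dl l0 e_gt0.
  exists r => //; split.
    move=> s as_ sc crs; apply: controlled_decrease_slope => //.
    by have [|/(_ sc)] := slope s; first by rewrite ltr_distl; lra.
  move=> t ct tcr; apply: controlled_decrease_slope => //.
  by have [|_ /(_ ct)] := slope t; first by rewrite ltr_distl; lra.
move=> [n [u [v [uv uvU duv H]]]].
have uvi i : u i <= v i by have [] := uv i.
have : \sum_(i < n) `|f (v i) - f (u i)| < e.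
  apply: acfd => //; first by move=> i; have [] := uv i.
  by rewrite -lte_fin; exact: le_lt_trans (sum_itv_le_measure mU uvi uvU duv) Ud.
have : e * (b - a) + e = e0.
  by rewrite -[X in _ + X]mulr1 -mulrDr /e divfK// gt_eqF// ltr_wpDl// subr_ge0.
lra.
Qed.

Lemma abs_continuous_id {R : realType} (a b : R) : abs_continuous a b id.
Proof.
move=> e e0; exists e => // n u v uv _; apply: le_lt_trans.
by apply: ler_sum => i _; have [_ [uvi _]] := uv i; rewrite ger0_norm ?subr_ge0.
Qed.

Lemma abs_continuousB {R : realType} (a b : R) (f g : R -> R) :
  abs_continuous a b f -> abs_continuous a b g -> abs_continuous a b (f \- g).
Proof.
move=> acf acg e e0.
have [d d0 fd] := acf _ (divr_gt0 e0 (ltr0Sn R 1)).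
have [d' d'0 gd] := acg _ (divr_gt0 e0 (ltr0Sn R 1)).
exists (Num.min d d') => [|n u v uv duv]; first by rewrite lt_min d0.
rewrite lt_min => /andP[uvd uvd'].
rewrite (splitr e); apply: le_lt_trans (ltrD (fd _ _ _ uv duv uvd) (gd _ _ _ uv duv uvd')).
rewrite -big_split/=; apply: ler_sum => i _.
by rewrite opprD addrACA -opprD (le_trans (ler_normB _ _)).
Qed.

Lemma abs_continuous_le {R : realType} (a b K : R) (f g : R -> R) :
  0 < K ->
  (forall u v, a <= u -> u <= v -> v <= b -> `|g v - g u| <= K * `|f v - f u|) ->
  abs_continuous a b f -> abs_continuous a b g.
Proof.
move=> K0 gf acf e e0; have [d d0 fd] := acf _ (divr_gt0 e0 K0).
exists d => // n u v uv duv uvd.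
have := fd n u v uv duv uvd; rewrite ltr_pdivlMr// mulrC.
apply: le_lt_trans; rewrite mulr_sumr; apply: ler_sum => i _.
by have [? [? ?]] := uv i; exact: gf.
Qed.

Lemma bounded_integrable d (T : measurableType d) {R : realType}
    (mu : {measure set T -> \bar R}) (D : set T) (g : T -> R) (M : R) :
  measurable D -> (mu D < +oo)%E -> measurable_fun D g ->
  (forall t, D t -> `|g t| <= M) -> mu.-integrable D (EFin \o g).
Proof.
move=> mD muD mg gM; apply: measurable_bounded_integrable => //.
by exists M; split => [|r Mr t Dt]; [exact: num_real|exact: le_trans (gM _ Dt) (ltW Mr)].
Qed.

Lemma itv_measure_lty {R : realType} (b0 b1 : bool) (a b : R) :
  (lebesgue_measure [set` Interval (BSide b0 a) (BSide b1 b)] < +oo)%E.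
Proof. by rewrite lebesgue_measure_itv/=; case: ifPn => // _; rewrite -EFinB ltry. Qed.

Lemma bounded_locally_integrable {R : realType} (g : R -> R) (M : R) :
  measurable_fun setT g -> (forall t, `|g t| <= M) -> locally_integrable setT g.
Proof.
move=> mg gM; split => //; first exact: openT.
move=> K _ cK.
have /integrableP[_] : lebesgue_measure.-integrable K (EFin \o g).
  apply: bounded_integrable => //.
  - exact: compact_measurable.
  - exact: compact_finite_measure.
  - exact: measurable_funTS.
by [].
Qed.

(** * The fundamental theorem of calculus with a bounded derivative *)

Section abs_continuous_FTC.
Context {R : realType} (a b M : R) (f g : R -> R).
Hypotheses (ab : a <= b) (acf : abs_continuous a b f).
Hypotheses (mg : measurable_fun setT g) (gM : forall t, `|g t| <= M).
Hypothesis dfg :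
  {ae @lebesgue_measure R, forall t, a < t < b -> is_derive t 1 f (g t)}.

Local Notation mu := (@lebesgue_measure R).
Let G (y : R) := \int[mu]_(t in `[a, y]) g t.

Let itv_integrable (b0 b1 : bool) (s t : R) :
  mu.-integrable [set` Interval (BSide b0 s) (BSide b1 t)] (EFin \o g).
Proof.
apply: bounded_integrable => //; [exact: itv_measure_lty|exact: measurable_funTS].
Qed.

(** The increment is the integral of [g] over []u, v]]; [M + 1] replaces [M] because
    [abs_continuous_le] asks for a positive constant. *)
Let G_lipschitz u v : a <= u -> u <= v -> v <= b -> `|G v - G u| <= (M + 1) * `|v - u|.
Proof.
move=> au uv vb; rewrite /G (Rintegral_itvB (itv_integrable _ _ _ _)) ?bnd_simp//.
apply: (le_trans (le_normr_Rintegral _ (itv_integrable _ _ _ _))) => //.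
apply: (@le_trans _ _ (\int[mu]_(t in `]u, v]) (M + 1))); last first.
  rewrite Rintegral_cst//= lebesgue_measure_itv/= lte_fin.
  move: uv; rewrite le_eqVlt => /predU1P[->|uv].
    by rewrite ltxx subrr normr0 !mulr0.
  by rewrite uv/= ger0_norm// subr_ge0 ltW.
apply: le_Rintegral => //.
- by have := integrable_norm (itv_integrable false false u v).
- by apply: bounded_integrable; [|exact: itv_measure_lty| |move=> t _; exact: lexx].
- by move=> t _; rewrite (le_trans (gM t))// lerDl.
Qed.

Let G_abs_continuous : abs_continuous a b G.
Proof.
apply: (@abs_continuous_le _ _ _ (M + 1) id) G_lipschitz (@abs_continuous_id _ _ _).
by rewrite ltr_wpDl// (le_trans _ (gM 0)).
Qed.

Let G_derive : {ae mu, forall t, a < t < b -> is_derive t 1 G (g t)}.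
Proof.
have intg y : mu.-integrable [set` Interval (BLeft a) (BRight y)] (EFin \o g).
  exact: itv_integrable.
have := FTC1 intg (bounded_locally_integrable mg gM).
apply: filterS; first exact: (ae_filter_ringOfSetsType mu).
move=> t H /andP[at_ _].
have [|dG gE] := H; first exact: at_.
by split => //; rewrite -derive1E.
Qed.

(** [f] and [G] have the same derivative almost everywhere, so [G \- f] and [f \- G] both have
    derivative 0 almost everywhere; monotonicity of each gives one inequality. *)
Lemma abs_continuous_FTC : f b - f a = \int[mu]_(t in `[a, b]) g t.
Proof.
have Ga : G a = 0 by rewrite /G set_itv1 Rintegral_set1.
apply/eqP; rewrite -/(G b) eq_le; apply/andP; split.
- suff : (G \- f) a <= (G \- f) b by rewrite /= Ga; lra.
  apply: abs_continuous_nondecreasing => //; first exact: abs_continuousB.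
  apply: filterS2 dfg G_derive; first exact: (ae_filter_ringOfSetsType mu).
  move=> t df dG at_; exists 0 => //.
  rewrite -(subrr (g t)); exact: is_deriveB (dG at_) (df at_).
- suff : (f \- G) a <= (f \- G) b by rewrite /= Ga; lra.
  apply: abs_continuous_nondecreasing => //; first exact: abs_continuousB.
  apply: filterS2 dfg G_derive; first exact: (ae_filter_ringOfSetsType mu).
  move=> t df dG at_; exists 0 => //.
  rewrite -(subrr (g t)); exact: is_deriveB (df at_) (dG at_).
Qed.

End abs_continuous_FTC.

(** * Measurability and Fubini for bounded functions *)

(** Rounding time down to the grid of step [1 / (n + 1)] gives functions that are measurable on each
    of countably many strips, and continuity in time makes them converge pointwise. *)
Lemma caratheodory_measurable d (T : measurableType d) {R : realType} (X : R -> T -> R) :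
  (forall t, measurable_fun setT (X t)) -> (forall a, continuous (X ^~ a)) ->
  measurable_fun setT (fun p : R * T => X p.1 p.2).
Proof.
move=> mX cX.
pose s n (t : R) : R := (Num.floor (t * n.+1%:R))%:~R / n.+1%:R.
apply: (measurable_fun_cvg (h := fun n p => X (s n p.1) p.2)).
- move=> n _ Y mY; rewrite setTI.
  pose I (k : int) : set R := `[k%:~R / n.+1%:R, (k + 1)%:~R / n.+1%:R[%classic.
  rewrite (_ : _ @^-1` _ = \bigcup_k (I k `*` (X (k%:~R / n.+1%:R) @^-1` Y))).
    apply: countable_bigcupT_measurable => [|k]; first exact: countableP.
    apply: measurableX; first exact: measurable_itv.
    by rewrite -[X in measurable X]setTI; exact: mX.
  have IE k t : I k t <-> Num.floor (t * n.+1%:R) = k.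
    rewrite /I/= in_itv/= ler_pdivrMr// ltr_pdivlMr// -floor_eq.
    by split => /eqP.
  apply/seteqP; split => [[t a] /= Yta|[t a] [k _] /= [/IE <- //]].
  by exists (Num.floor (t * n.+1%:R)) => //; split => //; apply/IE.
- move=> [t a] _ /=.
  apply: (@cvg_comp _ _ _ (fun n => s n t) (X ^~ a) \oo (nbhs t)); last exact: cX.
  apply: (@squeeze_cvgr _ _ _ _ (fun n => t - n.+1%:R^-1) (cst t)).
  + near=> n; rewrite /s /= ler_pdivrMr// floor_le andbT.
    rewrite lerBlDr -[X in _ + X]mul1r -mulrDl ler_pdivlMr//.
    by rewrite -intrD1 ltW// floorD1_gt.
  + rewrite -[X in _ --> X]subr0; apply: cvgB; first exact: cvg_cst.
    exact: cvg_harmonic.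
  + exact: cvg_cst.
Unshelve. all: by end_near. Qed.

Section bounded_fubini.
Context d1 d2 (T1 : measurableType d1) (T2 : measurableType d2) {R : realType}.
Variables (P1 : probability T1 R) (P2 : probability T2 R) (F : T1 * T2 -> R) (M : R).
Hypotheses (mF : measurable_fun setT F) (FM : forall z, `|F z| <= M).

Lemma probability_bounded_integrable d (T : measurableType d) (P : probability T R)
    (g : T -> R) (K : R) :
  measurable_fun setT g -> (forall z, `|g z| <= K) -> P.-integrable setT (EFin \o g).
Proof.
move=> mg gK; apply: bounded_integrable => //.
by rewrite -ge0_fin_numE// fin_num_measure.
Qed.

Lemma probability_Rintegral_le d (T : measurableType d) (P : probability T R)
    (g : T -> R) (K : R) :
  measurable_fun setT g -> (forall z, `|g z| <= K) -> `|\int[P]_x g x| <= K.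
Proof.
move=> mg gK.
have ig := probability_bounded_integrable P mg gK.
apply: (le_trans (le_normr_Rintegral _ ig)) => //.
have <- : \int[P]_x (cst K x) = K by rewrite Rintegral_cst//= probability_setT mulr1.
apply: le_Rintegral => //; first exact: integrable_norm ig.
exact: finite_measure_integrable_cst.
Qed.

Lemma measurable_bounded_Rintegral : measurable_fun setT (fun x => \int[P2]_y F (x, y)).
Proof.
have mFx x : measurable_fun setT (fun y => F (x, y)) by exact: measurableT_comp.
(* Adding [M] makes the integrand nonnegative, so that Tonelli's theorem yields measurability. *)
rewrite (_ : (fun x => _) = fun x => fine (\int[P2]_y (F (x, y) + M)%:E) - M).
  apply: measurable_funB => //; apply: measurableT_comp => //.
  apply: (measurable_fun_fubini_tonelli_F (fun z => (F z + M)%:E)).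
    by apply/measurable_EFinP; exact: measurable_funD.
  by move=> z; rewrite lee_fin -lerBlDr sub0r; have := FM z; rewrite ler_norml => /andP[].
apply/funext => x; rewrite -/(Rintegral _ _ _) RintegralD//.
- by rewrite Rintegral_cst//= probability_setT mulr1 addrK.
- by apply: (@probability_bounded_integrable _ _ _ _ M).
- exact: finite_measure_integrable_cst.
Qed.

Lemma bounded_Fubini :
  \int[P1]_x \int[P2]_y F (x, y) = \int[P2]_y \int[P1]_x F (x, y).
Proof.
have iF : (P1 \x P2)%E.-integrable setT (EFin \o F).
  apply: (bounded_integrable (M := M)) => //.
  rewrite -setXTT [ltLHS]product_measure1E//.
  by rewrite [X in (X * _)%E](probability_setT P1) [X in (_ * X)%E](probability_setT P2) mule1 ltry.
have := Fubini iF; rewrite /Rintegral => FF; congr fine.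
transitivity (\int[P1]_x \int[P2]_y (F (x, y))%:E)%E.
  apply: eq_integral => x _; rewrite fineK//.
  apply: integrable_fin_num => //; apply: (@probability_bounded_integrable _ _ _ _ M) => //.
  exact: measurableT_comp.
rewrite FF; apply: eq_integral => y _; rewrite fineK//.
apply: integrable_fin_num => //; apply: (@probability_bounded_integrable _ _ _ _ M) => //.
exact: measurableT_comp.
Qed.

End bounded_fubini.

Lemma Rintegral_uniform {R : realType} (a b M : R) (ab : a < b) (g : R -> R) :
  measurable_fun setT g -> (forall t, `|g t| <= M) ->
  \int[lebesgue_measure]_(t in `[a, b]) g t = (b - a) * \int[uniform_prob ab]_t g t.
Proof.
move=> mg gM.
have g0 t : 0 <= g t + M by have := gM t; rewrite ler_norml -lerBlDr sub0r => /andP[].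
have ig : (@lebesgue_measure R).-integrable `[a, b] (EFin \o g).
  apply: bounded_integrable => //; [exact: itv_measure_lty|exact: measurable_funTS].
have iM : (@lebesgue_measure R).-integrable `[a, b] (EFin \o cst M).
  by apply: (bounded_integrable (M := `|M|)) => //; exact: itv_measure_lty.
have ba0 : b - a != 0 by rewrite subr_eq0 gt_eqF.
have E : \int[uniform_prob ab]_t (g t + M) =
    (b - a)^-1 * \int[lebesgue_measure]_(t in `[a, b]) (g t + M).
  rewrite /Rintegral integral_uniform//.
  - rewrite fineM//; apply: integrable_fin_num => //.
    by rewrite (_ : (fun t => _) = ((EFin \o g) \+ (EFin \o cst M))%E)//; exact: integrableD.
  - by apply/measurable_EFinP; exact: measurable_funD.
have iU := probability_bounded_integrable (uniform_prob ab) mg gM.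
have iUM := finite_measure_integrable_cst (uniform_prob ab) M measurableT.
move: E; rewrite RintegralD// [in RHS]RintegralD// !Rintegral_cst//= probability_setT.
rewrite lebesgue_measure_itv/= lte_fin ab/= mulr1 mulrDr => E.
have -> : \int[uniform_prob ab]_t g t = (b - a)^-1 * \int[lebesgue_measure]_(t in `[a, b]) g t.
  by apply: (addIr M); rewrite E mulrCA mulVf// mulr1.
by rewrite mulVKf.
Qed.

Lemma Rintegral_le0 d (T : measurableType d) {R : realType}
    (mu : {measure set T -> \bar R}) (D : set T) (g : T -> R) :
  measurable D -> mu.-integrable D (EFin \o g) -> (forall x, D x -> g x <= 0) ->
  \int[mu]_(x in D) g x <= 0.
Proof.
move=> mD ig g0; rewrite -[leRHS](mul0r (fine (mu D))) -Rintegral_cst//.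
by apply: le_Rintegral => //; exact: integrable0.
Qed.

Lemma nondecreasing_norm_le {R : realDomainType} (f1 : R -> R) (M : R) :
  {homo f1 : y z / y <= z} ->
  forall c, `|c| <= M -> `|f1 c| <= Num.max `|f1 (- M)| `|f1 M|.
Proof.
move=> nf1 c cM; have /andP[Mc {}cM] : - M <= c <= M by rewrite -ler_norml.
move: (nf1 _ _ Mc) (nf1 _ _ cM) => {}Mc {}cM; rewrite le_max.
have [c0|c0] := leP 0 (f1 c).
  by apply/orP; right; rewrite !ger0_norm// (le_trans c0 cM).
by apply/orP; left; rewrite !ltr0_norm ?lerN2// (le_lt_trans Mc c0).
Qed.

Lemma lipschitz_nondecreasing_derive {R : realType} (f f1 : R -> R) (M : R) :
  (forall y : R, is_derive y 1 f (f1 y)) -> {homo f1 : y z / y <= z} ->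
  forall y z, `|y| <= M -> `|z| <= M ->
    `|f z - f y| <= Num.max `|f1 (- M)| `|f1 M| * `|z - y|.
Proof.
move=> df nf1 y z yM zM; wlog yz : y z yM zM / y <= z.
  move=> H; have [/H|/ltW/H] := leP y z; first exact.
  by rewrite distrC (distrC y); exact.
have [|c] := MVT_segment yz (fun t _ => df t).
  apply: continuous_subspaceT => t; apply: differentiable_continuous.
  by apply/derivable1_diffP; have [] := df t.
rewrite in_itv/= => /andP[yc cz] ->; rewrite normrM ler_wpM2r//.
apply: nondecreasing_norm_le => //; move: yM zM; rewrite !ler_norml; lra.
Qed.

(** * Convex functionals decrease *)

Section convex_functional.
Context {R : realType} (S T : R) (ST : S < T).
Variables (X : R -> R -> R) (k : R -> R -> R -> R) (W M : R).
Let P : probability _ R := uniform_prob (@ltr01 R).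
Let V (t a : R) : R := \int[P]_b (k t a b * (X t b - X t a)).
Hypotheses (mX : measurable_fun setT (fun p : R * R => X p.1 p.2))
  (mk : measurable_fun setT (fun p : R * R * R => k p.1.1 p.1.2 p.2))
  (k_ge0 : forall t a b, 0 <= k t a b) (kW : forall t a b, k t a b <= W)
  (k_sym : forall t a b, k t a b = k t b a) (XM : forall t a, `|X t a| <= M)
  (acX : forall a, abs_continuous S T (X ^~ a))
  (odeX : forall a, {ae @lebesgue_measure R, forall t, S < t < T ->
     is_derive t 1 (X ^~ a) (V t a)}).

Variables (f f1 : R -> R).
Hypotheses (df : forall y : R, is_derive y 1 f (f1 y))
  (nf1 : {homo f1 : y z / y <= z}).

Let mf : measurable_fun setT f.
Proof.
apply: continuous_measurable_fun => t; apply: differentiable_continuous.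
by apply/derivable1_diffP; have [] := df t.
Qed.

Let mf1 : measurable_fun setT f1.
Proof. exact: nondecreasing_measurable. Qed.

Let mXt t : measurable_fun setT (X t).
Proof. by have := measurable_fun_pair2 t mX. Qed.

Let C := Num.max `|f1 (- M)| `|f1 M|.

Let C_ge0 : 0 <= C. Proof. by rewrite le_max normr_ge0. Qed.

Let W_ge0 : 0 <= W. Proof. exact: le_trans (k_ge0 0 0 0) (kW 0 0 0). Qed.

Lemma flux_bound t a b : `|k t a b * (X t b - X t a)| <= W * (M + M).
Proof.
rewrite normrM; apply: ler_pM => //; first by rewrite ger0_norm.
by rewrite (le_trans (ler_normB _ _))// lerD.
Qed.

Lemma measurable_flux : measurable_fun setT
  (fun p : R * R * R => k p.1.1 p.1.2 p.2 * (X p.1.1 p.2 - X p.1.1 p.1.2)).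
Proof.
apply: measurable_funM => //; apply: measurable_funB.
- apply: (measurableT_comp (g := fun p : R * R * R => (p.1.1, p.2)) mX).
  by apply: measurable_fun_pair => //; exact: measurableT_comp.
- exact: measurableT_comp mX measurable_fst.
Qed.

Let mV : measurable_fun setT (fun p : R * R => V p.1 p.2).
Proof.
exact: (@measurable_bounded_Rintegral _ _ _ _ _ P _ _ measurable_flux (fun=> flux_bound _ _ _)).
Qed.

Let V_bound t a : `|V t a| <= W * (M + M).
Proof.
apply: probability_Rintegral_le; last exact: flux_bound.
exact: (measurable_fun_pair2 (t, a) measurable_flux).
Qed.

Let g (z : R * R) := f1 (X z.1 z.2) * V z.1 z.2.

Let mg : measurable_fun setT g.
Proof. by apply: measurable_funM => //; exact: measurableT_comp. Qed.

Let g_bound z : `|g z| <= C * (W * (M + M)).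
Proof. by rewrite normrM ler_pM// nondecreasing_norm_le. Qed.

(** [f] is Lipschitz on [[- M, M]] with constant [C], so [f \o X ^~ a] is absolutely continuous; by
    the chain rule its derivative is [g] at almost every time. *)
Let increment a : f (X T a) - f (X S a) = (T - S) * \int[uniform_prob ST]_t g (t, a).
Proof.
rewrite -(Rintegral_uniform (M := C * (W * (M + M)))) //; last first.
  exact: measurableT_comp.
apply: (abs_continuous_FTC (M := C * (W * (M + M))) (f := f \o X ^~ a)) => //.
- exact: ltW.
- apply: (@abs_continuous_le _ _ _ (C + 1) (X ^~ a)) => //.
    by rewrite ltr_wpDl.
  move=> u v _ _ _ /=; apply: (le_trans (lipschitz_nondecreasing_derive df nf1 (XM _ _) (XM _ _))).
  by rewrite ler_wpM2r// lerDl.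
- exact: measurableT_comp.
- apply: filterS (odeX a); first exact: (ae_filter_ringOfSetsType lebesgue_measure).
  by move=> t H /H dX; apply: is_derive1_comp.
Qed.

(* Exchanging [a] and [b] and averaging turns the integrand into
   [- k (f1 (X b) - f1 (X a)) (X b - X a) / 2]. *)
Let mean_dissipation t : \int[P]_a g (t, a) <= 0.
Proof.
pose h (z : R * R) := f1 (X t z.1) * (k t z.1 z.2 * (X t z.2 - X t z.1)).
have mh : measurable_fun setT h.
  apply: measurable_funM; first by do 2 apply: measurableT_comp => //.
  apply: (measurableT_comp (g := fun z : R * R => ((t, z.1), z.2)) measurable_flux).
  by apply: measurable_fun_pair => //; exact: measurable_fun_pair.
have h_bound z : `|h z| <= C * (W * (M + M)).
  rewrite normrM; apply: ler_pM => //; first exact: nondecreasing_norm_le.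
  exact: flux_bound.
have mh' : measurable_fun setT (fun z => h (z.2, z.1)).
  by apply: (measurableT_comp (g := fun z : R * R => (z.2, z.1)) mh); exact: measurable_fun_pair.
have gE a : g (t, a) = \int[P]_b h (a, b).
  rewrite /g /h /= RintegralZl//; apply: (probability_bounded_integrable P _ (flux_bound t a)).
  exact: (measurable_fun_pair2 (t, a) measurable_flux).
have hI a : P.-integrable setT (EFin \o (fun b => h (a, b))).
  by apply: (probability_bounded_integrable P _ (fun=> h_bound _)); exact: measurableT_comp.
have hI' a : P.-integrable setT (EFin \o (fun b => h (b, a))).
  by apply: (probability_bounded_integrable P _ (fun=> h_bound _)); exact: measurableT_comp.
have HI : P.-integrable setT (EFin \o (fun a => \int[P]_b h (a, b))).
  apply: (@probability_bounded_integrable R _ _ _ _ (C * (W * (M + M)))) => //.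
    exact: (measurable_bounded_Rintegral P mh h_bound).
  by move=> a; apply: probability_Rintegral_le => //; exact: measurableT_comp.
have HI' : P.-integrable setT (EFin \o (fun a => \int[P]_b h (b, a))).
  apply: (@probability_bounded_integrable R _ _ _ _ (C * (W * (M + M)))) => //.
    exact: (measurable_bounded_Rintegral P mh' (fun=> h_bound _)).
  by move=> a; apply: probability_Rintegral_le => //; exact: measurableT_comp.
under eq_Rintegral do rewrite gE.
have swap : \int[P]_a \int[P]_b h (a, b) = \int[P]_a \int[P]_b h (b, a).
  by rewrite (bounded_Fubini P P mh h_bound).
suff : \int[P]_a \int[P]_b h (a, b) + \int[P]_a \int[P]_b h (b, a) <= 0.
  by rewrite -swap -mulr2n pmulrn_lle0.
rewrite -RintegralD//.
apply: Rintegral_le0 => //.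
- by have := integrableD measurableT HI HI'; apply: eq_integrable => // a _ /=; rewrite EFinD.
move=> a _; rewrite -RintegralD//=.
apply: Rintegral_le0 => //.
- have := integrableD measurableT (hI a) (hI' a).
  by apply: eq_integrable => // b _ /=; rewrite EFinD.
move=> b _; rewrite /h/= (k_sym t b a).
have -> : f1 (X t a) * (k t a b * (X t b - X t a)) + f1 (X t b) * (k t a b * (X t a - X t b))
  = - (k t a b * ((f1 (X t b) - f1 (X t a)) * (X t b - X t a))) by ring.
rewrite oppr_le0 mulr_ge0//.
have [ab|/ltW ab] := leP (X t a) (X t b).
  by rewrite mulr_ge0// subr_ge0// nf1.
by rewrite mulr_le0// subr_le0// nf1.
Qed.

(** The difference of the two sides is the average over agents of the increments; once time and
    agents are exchanged, [mean_dissipation] applies at each time. *)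
Lemma convex_functional_le : \int[P]_a f (X T a) <= \int[P]_a f (X S a).
Proof.
have fI t : P.-integrable setT (EFin \o (fun a => f (X t a))).
  apply: (@probability_bounded_integrable R _ _ _ _ (C * (M + M) + `|f (X 0 0)|)).
    exact: (measurableT_comp mf (mXt t)).
  move=> a; rewrite -lerBlDr (le_trans (lerB_dist _ _))//.
  apply: (le_trans (lipschitz_nondecreasing_derive df nf1 (XM _ _) (XM _ _))).
  by rewrite ler_wpM2l// (le_trans (ler_normB _ _))// lerD.
rewrite -subr_le0 -RintegralB//.
under eq_Rintegral do rewrite increment.
rewrite RintegralZl//; last first.
  apply: (@probability_bounded_integrable R _ _ _ _ (C * (W * (M + M)))).
    apply: (@measurable_bounded_Rintegral _ _ _ _ _ (uniform_prob ST)
      (fun z => g (z.2, z.1)) (C * (W * (M + M)))) => //.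
    by apply: (measurableT_comp (g := fun z : R * R => (z.2, z.1)) mg); exact: measurable_fun_pair.
  by move=> a; apply: probability_Rintegral_le => //; exact: measurableT_comp.
rewrite -(bounded_Fubini (uniform_prob ST) P mg g_bound).
rewrite pmulr_rle0 ?subr_gt0//.
apply: Rintegral_le0 => //.
apply: (@probability_bounded_integrable R _ _ _ _ (C * (W * (M + M)))).
  exact: (measurable_bounded_Rintegral P mg g_bound).
by move=> t; apply: probability_Rintegral_le => //; exact: measurableT_comp.
Qed.

End convex_functional.

(** * Quantile functions *)

Lemma uniform01E {R : realType} (A : set R) : measurable A ->
  uniform_prob (@ltr01 R) A = lebesgue_measure (A `&` `[0, 1]).
Proof.
move=> mA; rewrite /uniform_prob integral_uniform_pdf.
rewrite (eq_integral (cst 1%E)) => [|x]; last first.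
  by rewrite inE => -[_ /=]; rewrite in_itv/= /uniform_pdf => ->; rewrite subr0 invr1.
by rewrite integral_cst/= ?mul1e//; exact: measurableI.
Qed.

Lemma uniform01_itv_oo {R : realType} (A : set R) : measurable A ->
  uniform_prob (@ltr01 R) A = lebesgue_measure (A `&` `]0, 1[).
Proof.
move=> mA; rewrite uniform01E//.
have mAoo : measurable (A `&` `]0, 1[) by exact: measurableI.
have mAcc : measurable (A `&` `[0, 1]) by exact: measurableI.
have m01 : measurable [set (0 : R); 1] by exact: measurableU.
have le01 : A `&` `[0, 1] `<=` (A `&` `]0, 1[) `|` [set 0; 1].
  move=> x [Ax]; rewrite /= !in_itv/= => /andP[].
  rewrite !le_eqVlt => /predU1P[<-|x0]; first by right; left.
  by move=> /predU1P[->|x1]; [right; right|left; split => //; rewrite x0].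
apply/eqP; rewrite eq_le; apply/andP; split.
  have <- : lebesgue_measure ((A `&` `]0, 1[) `|` [set 0; 1]) =
      lebesgue_measure (A `&` `]0, 1[).
    apply: measureU0 => //.
    by apply: countable_lebesgue_measure0; exact: finite_set_countable.
  by apply: le_measure; rewrite ?inE//; exact: measurableU.
by apply: le_measure; rewrite ?inE//; apply: setIS; exact: subset_itv_oo_cc.
Qed.

Section quantile.
Context d (T : measurableType d) {R : realType} (P : probability T R).
Variable Y : {RV P >-> R}.
Hypothesis Y01 : P (Y @^-1` `[0, 1]) = 1%E.

Definition rcdf (c : R) : R := fine (cdf Y c).

(* The values outside ]0, 1[ are irrelevant, and make the function monotone. *)
Definition quantile (u : R) : R :=
  if u <= 0 then 0 else if 1 <= u then 1 else inf [set c | u <= rcdf c].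

Lemma rcdfE c : (rcdf c)%:E = cdf Y c.
Proof. by rewrite /rcdf fineK// fin_num_measure. Qed.

Lemma rcdf_nondecreasing : {homo rcdf : b c / b <= c}.
Proof. by move=> b c bc; rewrite -lee_fin !rcdfE; exact: cdf_nondecreasing. Qed.

Lemma rcdf_le1 c : rcdf c <= 1.
Proof. by rewrite -lee_fin rcdfE; exact: cdf_le1. Qed.

Lemma rcdf_ge0 c : 0 <= rcdf c.
Proof. by rewrite -lee_fin rcdfE; exact: cdf_ge0. Qed.

Let mY (A : set R) : measurable A -> measurable (Y @^-1` A).
Proof. exact: measurable_funPTI. Qed.

Lemma rcdf_eq1 c : 1 <= c -> rcdf c = 1.
Proof.
move=> c1; apply/eqP; rewrite eq_le rcdf_le1/= -lee_fin rcdfE -Y01.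
apply: (@le_measure _ _ _ P); rewrite ?inE; [exact: mY|exact: mY|].
by move=> x /=; rewrite !in_itv/= => /andP[_ x1]; exact: le_trans x1 c1.
Qed.

Lemma rcdf_eq0 c : c < 0 -> rcdf c = 0.
Proof.
move=> c0; apply/eqP; rewrite eq_le rcdf_ge0 andbT -lee_fin rcdfE.
have <- : P (~` (Y @^-1` `[0, 1])) = 0%:E.
  by rewrite probability_setC ?Y01 ?subee//; exact: mY.
apply: (@le_measure _ _ _ P); rewrite ?inE; [exact: mY|apply: measurableC; exact: mY|].
by move=> x /=; rewrite !in_itv/= => xc /andP[x0 _]; have := lt_le_trans c0 x0; rewrite ltNge xc.
Qed.

(** The infimum defining the quantile is attained because distribution functions are
    right-continuous; [Y01] makes the set nonempty and bounded below. This equivalence moves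
    estimates between [rcdf] and quantiles. *)
Lemma quantile_le u c : 0 < u < 1 -> (quantile u <= c) = (u <= rcdf c).
Proof.
move=> /andP[u0 u1]; rewrite /quantile !leNgt u0 u1/=.
set E := [set _ | _].
have E0 : lbound E 0.
  by move=> b ub; rewrite leNgt; apply/negP => b0; move: ub; rewrite /E/= rcdf_eq0// leNgt u0.
have E1 : E 1 by rewrite /E/= rcdf_eq1// ltW.
rewrite -!leNgt; apply/idP/idP => [Ec|uc]; last first.
  by apply: ge_inf => //; exists 0.
rewrite -lee_fin rcdfE; apply: cvge_ge; last exact: (@cdf_right_continuous _ _ _ P Y c).
  exact: at_right_proper_filter.
near=> r; have cr : inf E < r by rewrite (le_lt_trans Ec).
have [b Eb br] := inf_lt (ex_intro _ 1 E1) cr.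
by rewrite -rcdfE lee_fin (le_trans Eb)// rcdf_nondecreasing// ltW.
Unshelve. all: by end_near. Qed.

Lemma quantile_le1 u : quantile u <= 1.
Proof.
have [u0|u0] := leP u 0; first by rewrite /quantile u0.
have [u1|u1] := leP 1 u; first by rewrite /quantile [u <= 0]leNgt u0/= u1.
by rewrite quantile_le ?u0// rcdf_eq1// ltW.
Qed.

Lemma quantile_ge0 u : 0 <= quantile u.
Proof.
rewrite /quantile; case: (leP u 0) => // u0; case: (leP 1 u) => // u1; apply: lb_le_inf.
  by exists 1; rewrite /= rcdf_eq1// ltW.
by move=> b /= ub; rewrite leNgt; apply/negP => b0; move: ub; rewrite rcdf_eq0// leNgt u0.
Qed.

Lemma quantile_nondecreasing : {homo quantile : u v / u <= v}.
Proof.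
move=> u v uv.
have [u0|u0] := leP u 0; first by rewrite {1}/quantile u0 quantile_ge0.
have [v1|v1] := leP 1 v.
  by rewrite {2}/quantile [v <= 0]leNgt (lt_le_trans u0 uv)/= v1 quantile_le1.
rewrite quantile_le ?u0 ?(le_lt_trans uv)// (le_trans uv)// -quantile_le//.
by rewrite (lt_le_trans u0).
Qed.

Lemma measurable_quantile : measurable_fun setT quantile.
Proof. exact: nondecreasing_measurable quantile_nondecreasing. Qed.

(** By [quantile_le], the levels in []0, 1[] whose quantile exceeds [c] form []rcdf c, 1[], of
    length [1 - rcdf c]. Both laws thus agree on the half-lines []c, +oo[], which are stable under
    intersection and generate the Borel sets. *)
Lemma distribution_quantile A : measurable A ->
  uniform_prob (@ltr01 R) (quantile @^-1` A) = distribution P Y A.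
Proof.
have mQ : @measurable_fun _ _ (measurableTypeR R) R setT quantile.
  exact: measurable_quantile.
pose Q : {mfun measurableTypeR R >-> R} := @mfun_Sub _ _ (measurableTypeR R) R _ (mem_set mQ).
move=> mA; rewrite -[LHS]/(distribution (uniform_prob (@ltr01 R)) Q A).
apply: (measure_unique (@RGenOInfty.G R) (fun n => `]- n%:R, +oo[%classic)
  _ _ _ _ (distribution (uniform_prob (@ltr01 R)) Q) (distribution P Y) _ _ A mA).
- exact: RGenOInfty.measurableE.
- move=> _ _ [b ->] [c ->]; exists (Num.max b c).
  by apply/seteqP; split => x /=; rewrite !in_itv/= !andbT gt_max => /andP//.
- by move=> n; exists (- n%:R).
- rewrite -subTset => x _; exists (Num.bound `|x|) => //=.
  by rewrite in_itv/= andbT ltrNl (le_lt_trans (ler_norm _))// normrN archi_boundP.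
- move=> _ [c ->].
  have mc : measurable (quantile @^-1` `]c, +oo[).
    by rewrite -[X in measurable X]setTI; exact: measurable_quantile.
  transitivity (1 - rcdf c)%:E; last first.
    by rewrite -setCitvl EFinB rcdfE [RHS]probability_setC.
  rewrite [LHS]uniform01_itv_oo//.
  have -> : quantile @^-1` `]c, +oo[ `&` `]0, 1[ = `]rcdf c, 1[%classic.
    apply/seteqP; split => u /=; rewrite !in_itv/= !andbT.
      by move=> [cu u01]; rewrite ltNge -quantile_le// -ltNge cu; case/andP: u01.
    move=> /andP[cu u1]; have u01 : 0 < u < 1 by rewrite (le_lt_trans (rcdf_ge0 c)).
    by rewrite ltNge quantile_le// -ltNge.
  rewrite lebesgue_measure_itv/= lte_fin.
  by have := rcdf_le1 c; rewrite le_eqVlt => /predU1P[->|->//]; rewrite ltxx subrr.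
- by move=> n; rewrite (le_lt_trans (probability_le1 _ _)) ?ltry.
Qed.

End quantile.

(** * Limits of quantile functions *)

Section quantile_limit.
Context d (T : measurableType d) {R : realType} (P : probability T R).
Variable Y : R -> {RV P >-> R}.
Hypothesis Y01 : forall t, P (Y t @^-1` `[0, 1]) = 1%E.
(* [L a b] is the limit of the expectation of a cutoff decreasing from 1 at a
   to 0 at b. *)
Variable L : R -> R -> R.
Hypothesis HL : forall a b, a < b -> forall e, 0 < e ->
  \forall t \near +oo, rcdf (Y t) a < L a b + e /\ L a b - e < rcdf (Y t) b.

(** For [u] in []0, 1[], membership of [a] certifies through [HL] that [rcdf (Y t) a < u], hence
    [a < quantile (Y t) u], for all large [t]. The supremum of such [a] is the candidate limit. *)
Let E (u : R) := [set a | exists2 b : R, a < b & L a b < u].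

Definition limit_quantile (u : R) : R :=
  if u <= 0 then 0 else if 1 <= u then 1 else sup (E u).

Let E_neg u a : 0 < u -> a < 0 -> E u a.
Proof.
move=> u0 a0; have a2 : a < a / 2.
  by rewrite ltr_pdivlMr// mulr_natr mulr2n gtrDl.
have a20 : a / 2 < 0 by rewrite pmulr_llt0.
(* [rcdf] vanishes at [a / 2], still negative, which forces [L a (a / 2) <= 0]. *)
exists (a / 2) => //.
apply: le_lt_trans u0; apply/ler_addgt0Pr => e e0; rewrite add0r.
have [t [_]] := filter_ex (HL a2 e0).
by rewrite (rcdf_eq0 (Y01 t))// ltrBlDr add0r => /ltW.
Qed.

Let E_le1 u : u < 1 -> ubound (E u) 1.
Proof.
move=> u1 a [b ab Lu]; rewrite leNgt; apply/negP => a1.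
have e0 : 0 < 1 - L a b by rewrite subr_gt0 (lt_trans Lu).
have [t [+ _]] := filter_ex (HL ab e0).
by rewrite (rcdf_eq1 (Y01 t)) ?ltW// subrKC ltxx.
Qed.

Let has_supE u : 0 < u < 1 -> has_sup (E u).
Proof.
move=> /andP[u0 u1]; split; last by exists 1; exact: E_le1.
by exists (-1); apply: E_neg => //; rewrite ltrN10.
Qed.

Lemma limit_quantile_ge0 u : 0 <= limit_quantile u.
Proof.
rewrite /limit_quantile; case: (leP u 0) => // u0; case: (leP 1 u) => // u1.
apply/ler_addgt0Pr => e e0; rewrite -lerBlDr sub0r.
apply: ub_le_sup; first by exists 1; exact: E_le1.
by apply: E_neg => //; rewrite oppr_lt0.
Qed.

Lemma limit_quantile_le1 u : limit_quantile u <= 1.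
Proof.
rewrite /limit_quantile; case: (leP u 0) => // u0; case: (leP 1 u) => // u1.
apply: ge_sup; last exact: E_le1.
by exists (-1); apply: E_neg => //; rewrite ltrN10.
Qed.

Lemma limit_quantile_nondecreasing : {homo limit_quantile : u v / u <= v}.
Proof.
move=> u v uv.
have [u0|u0] := leP u 0; first by rewrite {1}/limit_quantile u0 limit_quantile_ge0.
have v0 := lt_le_trans u0 uv.
have [v1|v1] := leP 1 v.
  by rewrite {2}/limit_quantile [v <= 0]leNgt v0/= v1 limit_quantile_le1.
have u1 := le_lt_trans uv v1.
rewrite /limit_quantile ![_ <= 0]leNgt u0 v0/= ![1 <= _]leNgt u1 v1/=.
apply: ge_sup; first by have [] := has_supE (introT andP (conj u0 u1)).
move=> a [b ab Lu]; apply: ub_le_sup; first by exists 1; exact: E_le1.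
by exists b => //; exact: lt_le_trans Lu uv.
Qed.

Lemma measurable_limit_quantile : measurable_fun setT limit_quantile.
Proof. exact: nondecreasing_measurable limit_quantile_nondecreasing. Qed.

(** The exceptional levels of [cvg_quantile]. Rational endpoints keep the set countable and are
    enough, since two of them fit in any interval to the right of [sup (E u)]. *)
Definition quantile_jumps : set R :=
  [set L (ratr p.1) (ratr p.2) | p in [set: rat * rat]].

Lemma countable_quantile_jumps : countable quantile_jumps.
Proof. by apply: sub_countable (card_image_le _ _) _; exact: countableP. Qed.

(* If [quantile (Y t) u] is below [a] and above [b > a] for arbitrarily large [t],
   then [u = L a b]; so only countably many [u] are bad. *)
Lemma cvg_quantile u : 0 < u < 1 -> ~ quantile_jumps u ->
  quantile (Y t) u @[t --> +oo] --> limit_quantile u.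
Proof.
move=> u01 Ju; case/andP: (u01) => u0 u1.
rewrite /limit_quantile leNgt u0/= leNgt u1/=.
apply/cvgrPdist_lt => e e0.
have [a [b ab Lu] aE] := sup_adherent e0 (has_supE u01).
have [p] : exists p : rat, ratr p \in `]sup (E u), sup (E u) + e[.
  by apply: rat_in_itvoo; rewrite ltrDl.
rewrite in_itv/= => /andP[Ep pe].
have [q] := rat_in_itvoo pe; rewrite in_itv/= => /andP[pq qe].
(* As [ratr p] lies above [sup (E u)], it is not in [E u], so [u] is at most this value of [L];
   equality would make [u] a jump. *)
have Lpq : u < L (ratr p) (ratr q).
  rewrite lt_neqAle; apply/andP; split.
    by apply/eqP => uL; apply: Ju; exists (p, q).
  rewrite leNgt; apply/negP => Lpq; move: Ep; rewrite ltNge => /negP; apply.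
  by apply: ub_le_sup; [exists 1; exact: E_le1|exists (ratr q)].
near=> t.
have aQ : a < quantile (Y t) u.
  rewrite ltNge quantile_le// -ltNge.
  (* The tolerance [u - L a b] turns the upper bound of [HL] into exactly [u]. *)
  have /= [] : rcdf (Y t) a < L a b + (u - L a b) /\ L a b - (u - L a b) < rcdf (Y t) b.
    by near: t; apply: HL => //; rewrite subr_gt0.
  by rewrite subrKC.
have Qq : quantile (Y t) u <= ratr q.
  rewrite quantile_le//.
  have /= [_] : rcdf (Y t) (ratr p) < L (ratr p) (ratr q) + (L (ratr p) (ratr q) - u) /\
      L (ratr p) (ratr q) - (L (ratr p) (ratr q) - u) < rcdf (Y t) (ratr q).
    by near: t; apply: HL => //; rewrite subr_gt0.
  by rewrite subKr => /ltW.
rewrite ltr_distl; apply/andP; split; lra.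
Unshelve. all: by end_near. Qed.

(* Quantile functions realize the distributions on a common space, where they
   converge almost surely; dominated convergence applies to indicators because
   the limit avoids the boundary of [A] almost surely. *)
Lemma limit_quantile_distribution :
  exists mu_oo : {measure set R -> \bar R}, mu_oo (~` `[0, 1]) = 0%E /\
    converges_in_distribution (fun t => distribution P (Y t)) mu_oo.
Proof.
pose U : probability _ R := uniform_prob (@ltr01 R).
have mQ : @measurable_fun _ _ (measurableTypeR R) R setT limit_quantile.
  exact: measurable_limit_quantile.
pose Q : {mfun measurableTypeR R >-> R} := @mfun_Sub _ _ (measurableTypeR R) R _ (mem_set mQ).
exists (distribution U Q); split.
  rewrite -[LHS]/(U (limit_quantile @^-1` ~` `[0, 1])).
  rewrite (_ : _ @^-1` _ = set0) ?measure0//.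
  apply/seteqP; split => // u /=; apply; rewrite in_itv/=.
  by rewrite limit_quantile_ge0 limit_quantile_le1.
(* Convergence at [+oo] is tested along sequences, the setting of dominated convergence. *)
move=> A mA A0; apply/cvge_pinftyP => s s_oo.
have mboundary : measurable (boundary A).
  apply: measurableD; first by apply: closed_measurable; exact: closed_closure.
  by apply: open_measurable; exact: open_interior.
have indicE' (q : R -> R) : measurable_fun setT q ->
    U (q @^-1` A) = (\int[U]_u (\1_A (q u))%:E)%E.
  move=> mq; rewrite -[X in U X]setIT -integral_indic//.
  by rewrite -[X in measurable X]setTI; exact: mq.
rewrite -[X in _ --> X]/(U (limit_quantile @^-1` A)) indicE'//.
rewrite (_ : (fun n => _) = fun n => (\int[U]_u (\1_A (quantile (Y (s n)) u))%:E)%E); last first.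
  apply/funext => n; rewrite -(distribution_quantile (Y01 (s n)) mA).
  apply: indicE'; apply: (measurable_quantile (Y01 (s n))).
have [] := @dominated_convergence _ _ _ U setT measurableT
  (fun n u => (\1_A (quantile (Y (s n)) u))%:E) (fun u => (\1_A (limit_quantile u))%:E) (cst 1%E).
- move=> n; apply/measurable_EFinP; apply: measurableT_comp => //.
  exact: measurable_quantile.
- by apply/measurable_EFinP; apply: measurableT_comp => //; exact: measurable_limit_quantile.
- have mJ : measurable quantile_jumps.
    by apply: countable_measurable => //; exact: countable_quantile_jumps.
  have mB : measurable (limit_quantile @^-1` boundary A).
    by rewrite -[X in measurable X]setTI; exact: measurable_limit_quantile.
  have mI : measurable (~` `]0, 1[ : set R) by exact: measurableC.
  have mJI : measurable (quantile_jumps `|` ~` `]0, 1[) by exact: measurableU.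
  (* Discarded levels: those where quantiles may fail to converge, those outside []0, 1[], and those
     sent to the boundary of [A], null by [A0]. *)
  exists (quantile_jumps `|` ~` `]0, 1[ `|` limit_quantile @^-1` boundary A); split.
  + exact: measurableU.
  + apply: null_set_setU => //; apply: null_set_setU => //.
      rewrite [LHS]uniform01E//; apply: countable_lebesgue_measure0.
      by apply: sub_countable (subset_card_le (@subIsetl _ _ _)) countable_quantile_jumps.
    by rewrite [LHS]uniform01_itv_oo// setICl measure0.
  + move=> u; apply: contra_notP => Nu _.
    have Ju : ~ quantile_jumps u by move=> ?; apply: Nu; left; left.
    have u01 : 0 < u < 1.
      by apply: contrapT => uI; apply: Nu; left; right => /=; rewrite in_itv.
    have Bu : ~ boundary A (limit_quantile u) by move=> ?; apply: Nu; right.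
    have cvQ : quantile (Y (s n)) u @[n --> \oo] --> limit_quantile u.
      exact: cvg_comp s_oo (cvg_quantile u01 Ju).
    (* Off the boundary the limit lies in the interior of [A] or in the open complement of its
       closure, so the indicators are eventually constant. *)
    have [clA|clA] := pselect (closure A (limit_quantile u)).
      have intA : A^° (limit_quantile u).
        by apply: contrapT => NA; apply: Bu.
      apply: cvg_near_cst; have : \forall n \near \oo, A (quantile (Y (s n)) u) := cvQ _ intA.
      apply: filterS => n An.
      by rewrite !indicE !mem_set//; exact: nbhs_singleton.
    have oC : nbhs (limit_quantile u) (~` closure A).
      by apply: open_nbhs_nbhs; split => //; apply: closed_openC; exact: closed_closure.
    apply: cvg_near_cst; have : \forall n \near \oo, ~ closure A (quantile (Y (s n)) u) := cvQ _ oC.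
    apply: filterS => n An.
    rewrite /= !indicE !memNset// => ?; [exact/clA/subset_closure|exact/An/subset_closure].
- exact: finite_measure_integrable_cst.
- by apply: aeW => u n _ /=; rewrite lee_fin indicE normr_nat lern1 leq_b1.
by [].
Qed.

End quantile_limit.

(** * Test functions *)

Definition sqr_pos {R : realDomainType} (y : R) : R := Num.max 0 y ^+ 2.

Lemma sqr_pos_ge0 {R : realDomainType} (y : R) : 0 <= sqr_pos y.
Proof. exact: sqr_ge0. Qed.

Lemma is_derive_sqr_pos {R : realType} (y : R) :
  is_derive y 1 (@sqr_pos R) (2 * Num.max 0 y).
Proof.
suff H : h^-1 *: ((sqr_pos \o shift y) (h *: 1) - sqr_pos y) @[h --> 0^'] --> 2 * Num.max 0 y.
  by split; [exact: cvgP H|exact: cvg_lim H].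
apply/cvgrPdist_le => e e0; near=> h.
have h0 : h != 0 by near: h; exact: nbhs_dnbhs_neq.
have he : `|h| <= e by near: h; exact: dnbhs0_le.
apply: le_trans he.
rewrite [_ *: _](_ : _ = h^-1 * (sqr_pos (h + y) - sqr_pos y)); last by rewrite /= [h *: 1]mulr1.
rewrite -[X in X - _](mulKf h0) -mulrBr normrM normfV mulrC ler_pdivrMr ?normr_gt0//.
rewrite -normrM -expr2 [leRHS]ger0_norm ?sqr_ge0// ler_norml /sqr_pos.
(* The remainder of the first-order expansion is at most [h ^+ 2] in absolute value, whatever the
   signs of [y] and [h + y]. *)
have [y0|y0] := leP 0 y; have [hy0|hy0] := leP 0 (h + y); apply/andP; split; nra.
Unshelve. all: by end_near. Qed.

Lemma is_derive_sqr_posB {R : realType} (c y : R) :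
  is_derive y 1 (fun x => sqr_pos (c - x)) (- (2 * Num.max 0 (c - y))).
Proof.
rewrite -mulrN1; apply: (@is_derive1_comp _ _ (fun x => c - x)); first exact: is_derive_sqr_pos.
by rewrite -[X in is_derive _ _ _ X]sub0r; apply: is_deriveB.
Qed.

Lemma is_derive_sqr_posBr {R : realType} (c y : R) :
  is_derive y 1 (fun x => sqr_pos (x - c)) (2 * Num.max 0 (y - c)).
Proof.
rewrite -[X in is_derive _ _ _ X]mulr1.
apply: (@is_derive1_comp _ _ (fun x => x - c)); first exact: is_derive_sqr_pos.
by rewrite -[X in is_derive _ _ _ X]subr0; apply: is_deriveB.
Qed.

Lemma continuous_sqr_pos {R : realType} : continuous (@sqr_pos R).
Proof.
move=> y; apply: differentiable_continuous; apply/derivable1_diffP.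
by have [] := is_derive_sqr_pos y.
Qed.

(* A normalized second difference of [c |-> (c - x)_+^2]. *)
Definition cutoff {R : realFieldType} (a b x : R) : R :=
  (sqr_pos (b - x) - 2 * sqr_pos ((a + b) / 2 - x) + sqr_pos (a - x)) / (2 * ((b - a) / 2) ^+ 2).

(** [cutoff a b x] is the average of the indicator of [x < c] over [c] in [[a, b]] against a tent
    density: the second difference integrates the second derivative in [c] against a tent, and the
    denominator normalizes it. *)
Lemma cutoff_bounds {R : realType} (a b x : R) : a < b ->
  [/\ 0 <= cutoff a b x, cutoff a b x <= 1, x <= a -> 1 <= cutoff a b x
    & b < x -> cutoff a b x <= 0].
Proof.
move=> ab; rewrite /cutoff; set h := (b - a) / 2.
have h0 : 0 < h by rewrite divr_gt0// subr_gt0.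
(* With [b] and the half-length [h] as parameters, the claims become polynomial inequalities once
   the denominator is cleared. *)
have aE : a = b - 2 * h by rewrite /h mulrC divfK//; ring.
have mE : (a + b) / 2 = b - h by rewrite /h; field.
rewrite mE {}aE {ab mE}; move: h h0 => h h0.
have hh : 0 < 2 * h ^+ 2 by rewrite mulr_gt0// exprn_gt0.
rewrite ler_pdivlMr// ler_pdivrMr// ler_pdivlMr// ler_pdivrMr// mul0r mul1r /sqr_pos.
have [b0|b0] := leP 0 (b - x); have [m0|m0] := leP 0 (b - h - x);
  have [a0|a0] := leP 0 (b - 2 * h - x); rewrite ?expr0n/=;
  split => [||xa|xb]; nra.
Qed.

(** * From monotone moments to a limit law *)

Section monotone_functionals.
Context d (T : measurableType d) {R : realType} (P : probability T R).
Variable Y : R -> {RV P >-> R}.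
Hypothesis Y01 : forall t, P (Y t @^-1` `[0, 1]) = 1%E.
Hypothesis Y_bounded : forall t, exists M : R, forall a, `|Y t a| <= M.
Hypothesis Y_noninc : forall c s t, s <= t ->
  \int[P]_a sqr_pos (c - Y t a) <= \int[P]_a sqr_pos (c - Y s a).

Let moment c t := \int[P]_a sqr_pos (c - Y t a).

Let measurable_moment c t : measurable_fun setT (fun a => sqr_pos (c - Y t a)).
Proof.
apply: (measurableT_comp (f := @sqr_pos R)).
  apply: continuous_measurable_fun; exact: continuous_sqr_pos.
by apply: measurable_funB => //; exact: measurable_funPT.
Qed.

Let integrable_moment c t : P.-integrable setT (EFin \o (fun a => sqr_pos (c - Y t a))).
Proof.
have [M YM] := Y_bounded t.
apply: (@probability_bounded_integrable R _ _ _ _ ((`|c| + M) ^+ 2)) => // a.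
rewrite normrX ler_pXn2r ?nnegrE//; last by rewrite addr_ge0// (le_trans _ (YM a)).
have : `|c - Y t a| <= `|c| + M by rewrite (le_trans (ler_normB _ _))// lerD2l.
by apply: le_trans; case: (leP 0 (c - Y t a)) => // _; rewrite normr0.
Qed.

Let cvg_moment c : exists l : R, moment c t @[t --> +oo] --> l.
Proof.
have nd : nondecreasing_fun (fun t => - moment c t) by move=> s t st; rewrite lerN2 Y_noninc.
have ub : has_ubound (range (fun t => - moment c t)).
  by exists 0 => _ [t _ <-]; rewrite oppr_le0 Rintegral_ge0// => a _; exact: sqr_pos_ge0.
have := nondecreasing_cvgr nd ub; set l := sup _ => ml; exists (- l).
rewrite (_ : moment c = fun t => - - moment c t); last by apply/funext => t; rewrite opprK.
exact: cvgN ml.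
Qed.

Let int_cutoff a b t := \int[P]_z cutoff a b (Y t z).

Let measurable_cutoff a b t : measurable_fun setT (fun z => cutoff a b (Y t z)).
Proof.
apply: measurable_funM => //; apply: measurable_funD => //; apply: measurable_funB => //.
exact: measurable_funM.
Qed.

Let cvg_cutoff a b : exists l : R, int_cutoff a b t @[t --> +oo] --> l.
Proof.
have [lb cb] := cvg_moment b; have [lm cm] := cvg_moment ((a + b) / 2).
have [la ca] := cvg_moment a.
exists ((lb - 2 * lm + la) / (2 * ((b - a) / 2) ^+ 2)).
have E t : int_cutoff a b t =
    (moment b t - 2 * moment ((a + b) / 2) t + moment a t) / (2 * ((b - a) / 2) ^+ 2).
  have im := integrable_moment.
  have i2 : P.-integrable setT (EFin \o (fun z => 2 * sqr_pos ((a + b) / 2 - Y t z))).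
    by have := integrableZl measurableT 2 (im ((a + b) / 2) t); apply: eq_integrable.
  have i3 : P.-integrable setT
      (EFin \o (fun z => sqr_pos (b - Y t z) - 2 * sqr_pos ((a + b) / 2 - Y t z))).
    by have := integrableB measurableT (im b t) i2; apply: eq_integrable.
  rewrite /int_cutoff /cutoff RintegralZr//; last first.
    by have := integrableD measurableT i3 (im a t); apply: eq_integrable.
  by rewrite RintegralD// RintegralB// RintegralZl.
under eq_fun do rewrite E.
by apply: cvgMl; apply: cvgD => //; apply: cvgB => //; apply: cvgMr.
Qed.

(** Pointwise, [cutoff a b] lies between the indicators of []-oo, a]] and []-oo, b]]. In the limit
    this becomes the hypothesis on [L] in [limit_quantile_distribution]. *)
Let cutoff_cdf a b t : a < b -> rcdf (Y t) a <= int_cutoff a b t <= rcdf (Y t) b.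
Proof.
move=> ab.
have rcdf_indic c : rcdf (Y t) c = \int[P]_z \1_(Y t @^-1` `]-oo, c]) z.
  rewrite /Rintegral integral_indic//; first by rewrite setIT.
  exact: measurable_funPTI.
have iI c : P.-integrable setT (EFin \o (\1_(Y t @^-1` `]-oo, c]) : T -> R)).
  apply: (@probability_bounded_integrable R _ _ _ _ 1).
    by apply: measurable_indic; exact: measurable_funPTI.
  by move=> z; rewrite indicE normr_nat lern1 leq_b1.
have iC : P.-integrable setT (EFin \o (fun z => cutoff a b (Y t z))).
  apply: (@probability_bounded_integrable R _ _ _ _ 1) => // z.
  by have [c0 c1 _ _] := cutoff_bounds (Y t z) ab; rewrite ger0_norm.
rewrite !rcdf_indic; apply/andP; split; apply: le_Rintegral => // z _.
- have [c0 _ c1 _] := cutoff_bounds (Y t z) ab; rewrite indicE.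
  by have [/set_mem/= /[!in_itv]/=/c1//|_] := boolP (z \in _).
- have [_ c1 _ c0] := cutoff_bounds (Y t z) ab; rewrite indicE.
  have [//|/negP zb] := boolP (z \in _); apply: c0; rewrite ltNge; apply/negP => Yb.
  by apply: zb; rewrite inE/= in_itv.
Qed.

Lemma monotone_functionals_limit :
  exists mu_oo : {measure set R -> \bar R}, mu_oo (~` `[0, 1]) = 0%E /\
    converges_in_distribution (fun t => distribution P (Y t)) mu_oo.
Proof.
have /choice[L cvL] : forall p : R * R, exists l : R, int_cutoff p.1 p.2 t @[t --> +oo] --> l.
  by move=> p; exact: cvg_cutoff.
apply: (limit_quantile_distribution Y01 (L := fun a b => L (a, b))) => a b ab e e0.
have /cvgrPdist_lt/(_ _ e0) := cvL (a, b).
apply: filterS => t /=; rewrite ltr_distlC => /andP[Lt tL].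
have /andP[at_ tb] := cutoff_cdf t ab.
by split; [exact: le_lt_trans at_ tL|exact: lt_le_trans Lt tb].
Qed.

End monotone_functionals.

(** * Solutions *)

Definition clamp {R : realDomainType} (a b t : R) : R := Num.max a (Num.min b t).

Lemma clamp_itv {R : realDomainType} (a b t : R) : a <= b -> a <= clamp a b t <= b.
Proof. by move=> ab; rewrite /clamp le_max lexx/= ge_max ab ge_min lexx. Qed.

Lemma clamp_id {R : realDomainType} (a b t : R) : a <= t <= b -> clamp a b t = t.
Proof. by move=> /andP[at_ tb]; rewrite /clamp (min_idPr tb) (max_idPr at_). Qed.

Lemma clamp_contraction {R : realDomainType} (a b s t : R) : s <= t ->
  clamp a b s <= clamp a b t /\ clamp a b t - clamp a b s <= t - s.
Proof.
move=> st; rewrite /clamp.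
have [h1|h1] := leP b s; have [h2|h2] := leP b t.
- by have [h3|h3] := leP a b; split; lra.
- by have [h3|h3] := leP a b; have [h4|h4] := leP a t; split; lra.
- by have [h3|h3] := leP a s; have [h4|h4] := leP a b; split; lra.
- by have [h3|h3] := leP a s; have [h4|h4] := leP a t; split; lra.
Qed.

Lemma measurable_clamp {R : realType} (a b : R) : measurable_fun setT (clamp a b).
Proof.
by apply: measurable_maxr => //; exact: measurable_minr.
Qed.

(** A single interval in the definition of absolute continuity gives uniform continuity, and
    clamping only shortens that interval. Continuity on the whole line is what
    [caratheodory_measurable] consumes. *)
Lemma abs_continuous_clamp_continuous {R : realType} (a b : R) (f : R -> R) :
  a <= b -> abs_continuous a b f -> continuous (fun t => f (clamp a b t)).
Proof.
move=> ab acf t; apply/cvgrPdist_lt => e e0.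
have [d d0 fd] := acf _ e0.
have H s s' : s <= s' -> s' - s < d -> `|f (clamp a b s') - f (clamp a b s)| < e.
  move=> ss' ssd; have [le_c c_le] := clamp_contraction a b ss'.
  have := fd 1%N (fun=> clamp a b s) (fun=> clamp a b s').
  rewrite !big_ord1; apply => [_||].
  - by have /andP[? _] := clamp_itv s ab; have /andP[_ ?] := clamp_itv s' ab.
  - by move=> i j _ _ _; rewrite !ord1.
  - exact: le_lt_trans ssd.
near=> s.
have std : `|t - s| < d by near: s; exact: cvgr_dist_lt.
have [ts|/ltW st] := leP t s.
  by rewrite distrC H// (le_lt_trans _ std)// distrC ler_norm.
by rewrite H// (le_lt_trans _ std)// ler_norm.
Unshelve. all: by end_near. Qed.

Section solution.
Context {R : realType} (w : R -> R -> R -> R -> R -> R) (x : R -> R -> R).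
Hypotheses (mw : weight_measurable w) (bw : weight_bounded w)
  (w_ge0 : weight_nonneg w) (w_sym : weight_symmetric w x)
  (solx : is_solution w x).

Local Notation U := (uniform_prob (@ltr01 R)).
Local Notation agent a := (clamp (0 : R) 1 a).

Let agent01 a : agent a \in `[0, 1].
Proof. by rewrite in_itv/= clamp_itv. Qed.

Lemma measurable_agent t : 0 <= t -> measurable_fun setT (fun a => x t (agent a)).
Proof.
move=> t0.
refine (@measurable_comp _ _ _ R R R [set` `[0, 1]] (x t) setT (clamp 0 1) _ _ _ _) => //.
- by move=> _ [a _ <-]; exact: agent01.
- exact: (solution_measurable solx t0).
- exact: measurable_clamp.
Qed.

Section time_window.
Variables (S T : R) (S0 : 0 <= S) (ST : S < T).

(* Clamping the arguments gives total functions satisfying all hypotheses globally. *)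
Let X t a := x (clamp S T t) (agent a).
Let k t a b := w (clamp S T t) (agent a) (agent b) (X t a) (X t b).

Let time_ge0 t : 0 <= clamp S T t.
Proof. by have /andP[+ _] := clamp_itv t (ltW ST); exact: le_trans. Qed.

Let X_abs_continuous a : abs_continuous S T (X ^~ a).
Proof.
have acx : abs_continuous S T (x ^~ (agent a)).
  move=> e e0; have T0 := le_trans S0 (ltW ST).
  have [d d0 H] := solution_abs_continuous solx (agent01 a) T0 e0.
  exists d => // n u v uv; apply: H => i; have [Su [? ?]] := uv i.
  by split => //; exact: le_trans Su.
apply: (@abs_continuous_le _ _ _ 1 (x ^~ (agent a))) => // u v Su uv vT.
have uST : S <= u <= T by rewrite Su (le_trans uv vT).
have vST : S <= v <= T by rewrite vT (le_trans Su uv).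
by rewrite mul1r /X (clamp_id uST) (clamp_id vST).
Qed.

Let measurable_X : measurable_fun setT (fun p : R * R => X p.1 p.2).
Proof.
apply: caratheodory_measurable => [t|a]; first exact: measurable_agent.
have acX := X_abs_continuous a.
(* Time gets clamped twice here, which changes nothing since [X] already clamps it. *)
have := abs_continuous_clamp_continuous (ltW ST) acX.
rewrite (_ : (fun t => _) = X ^~ a)//; apply/funext => t.
by rewrite /X (clamp_id (clamp_itv t (ltW ST))).
Qed.

Let measurable_k : measurable_fun setT (fun p : R * R * R => k p.1.1 p.1.2 p.2).
Proof.
pose g (p : R * R * R) : R * R * R * R * R :=
  ((((clamp S T p.1.1, agent p.1.2), agent p.2), X p.1.1 p.1.2), X p.1.1 p.2).
apply: (measurable_comp (F := @weight_domain R) (g := g) _ _ mw).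
- by do 4 (apply: measurableX => //).
- move=> _ [[[t a] b] _ <-]; rewrite /weight_domain/= !in_itv/= time_ge0.
  by rewrite !clamp_itv.
- apply: measurable_fun_pair; last first.
    apply: (measurableT_comp (g := fun p : R * R * R => (p.1.1, p.2)) measurable_X).
    by apply: measurable_fun_pair => //; exact: measurableT_comp.
  apply: measurable_fun_pair; last first.
    exact: (measurableT_comp measurable_X measurable_fst).
  apply: measurable_fun_pair; last first.
    exact: (measurableT_comp (measurable_clamp 0 1) measurable_snd).
  apply: measurable_fun_pair.
    by apply: (measurableT_comp (measurable_clamp S T)); exact: measurableT_comp.
  by apply: (measurableT_comp (measurable_clamp 0 1)); exact: measurableT_comp.
Qed.

Let X_bounded : exists M, forall t a, `|X t a| <= M.
Proof.
have [M xM] := solution_bounded solx (le_trans S0 (ltW ST)).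
exists M => t a; apply: xM; exists (clamp S T t), (agent a); split => //.
by rewrite in_itv/= time_ge0; have /andP[] := clamp_itv t (ltW ST).
Qed.

Let X_ode a : {ae @lebesgue_measure R, forall t, S < t < T ->
  is_derive t 1 (X ^~ a) (\int[U]_b (k t a b * (X t b - X t a)))}.
Proof.
apply: filterS (solution_ode solx (agent01 a)).
  exact: (ae_filter_ringOfSetsType lebesgue_measure).
move=> t odet /andP[St tT].
have tE : clamp S T t = t by rewrite clamp_id// !ltW.
have -> : \int[U]_b (k t a b * (X t b - X t a)) =
    \int[lebesgue_measure]_(b in `[0, 1])
      (w t (agent a) b (x t (agent a)) (x t b) * (x t b - x t (agent a))).
  have [M XM] := X_bounded; have [W wW] := bw.
  transitivity (\int[lebesgue_measure]_(b in `[0, 1]) (k t a b * (X t b - X t a))).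
    rewrite (Rintegral_uniform (M := W * (M + M)) ltr01) ?subr0 ?mul1r//.
      exact: (measurable_fun_pair2 (t, a) (measurable_flux measurable_X measurable_k)).
    apply: flux_bound => // [t' a' b'|t' a' b']; [exact: w_ge0|exact: wW].
  apply: eq_Rintegral => b; rewrite inE/= in_itv/= => b01.
  by rewrite /k /X tE [agent b]clamp_id.
(* Since [S < t < T] strictly, the clamp is the identity near [t]; and [0 <= S < t] gives the
   positive time that the equation asks for. *)
apply: near_eq_is_derive (odet (le_lt_trans S0 St)).
near=> s; rewrite /X [clamp S T s]clamp_id//; apply/andP; split; apply/ltW; near: s.
  exact: lt_nbhsr.
exact: lt_nbhsl.
Unshelve. all: by end_near. Qed.

(** In [k] the opinions are already substituted, so symmetry of [w] along the trajectory is plain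
    symmetry of [k] in the two agents. *)
Lemma solution_convex_le (f f1 : R -> R) :
  (forall y : R, is_derive y 1 f (f1 y)) -> {homo f1 : y z / y <= z} ->
  \int[U]_a f (x T (agent a)) <= \int[U]_a f (x S (agent a)).
Proof.
move=> df nf1; have [M XM] := X_bounded; have [W wW] := bw.
have := @convex_functional_le R S T ST X k W M measurable_X measurable_k _ _ _ XM
  X_abs_continuous X_ode f f1 df nf1.
rewrite /X [clamp S T T]clamp_id ?[clamp S T S]clamp_id ?lexx ?(ltW ST)//; apply => t a b.
- exact: w_ge0.
- exact: wW.
- exact: w_sym.
Qed.

End time_window.
End solution.

(** A nonnegative function with zero integral vanishes almost everywhere, and [sqr_pos (g z) = 0]
    means [g z <= 0]. *)
Lemma Rintegral_sqr_pos_le0 d (T : measurableType d) {R : realType} (P : probability T R)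
    (g : T -> R) (M : R) :
  measurable_fun setT g -> (forall z, `|g z| <= M) ->
  \int[P]_z sqr_pos (g z) <= 0 -> {ae P, forall z, g z <= 0}.
Proof.
move=> mg gM int0.
have ms : measurable_fun setT (fun z => sqr_pos (g z)).
  apply: (measurableT_comp (f := @sqr_pos R)) => //.
  apply: continuous_measurable_fun; exact: continuous_sqr_pos.
have isq : P.-integrable setT (EFin \o (fun z => sqr_pos (g z))).
  apply: (@probability_bounded_integrable R _ _ _ _ (M ^+ 2)) => // z.
  rewrite normrX ler_pXn2r ?nnegrE//; last by rewrite (le_trans _ (gM z)).
  by apply: le_trans (gM z); case: (leP 0 (g z)) => // _; rewrite normr0.
have /ae_eq_integral_abs : (\int[P]_(z in setT) `|(sqr_pos (g z))%:E| = 0)%E.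
  under eq_integral do rewrite gee0_abs ?lee_fin ?sqr_pos_ge0//.
  rewrite -[LHS]fineK; last exact: integrable_fin_num.
  congr EFin; apply/eqP; rewrite eq_le int0/= fine_ge0//.
  by apply: integral_ge0 => z _; rewrite lee_fin sqr_pos_ge0.
move=> /(_ measurableT); have mE := (measurable_EFinP _ _).2 ms => /(_ mE).
apply: filterS => z /(_ I) /= [] /eqP.
by rewrite /sqr_pos sqrf_eq0; case: leP => // g0; rewrite gt_eqF.
Qed.

Section opinion.
Context {R : realType} (w : R -> R -> R -> R -> R -> R) (x : R -> R -> R).
Hypotheses (mw : weight_measurable w) (bw : weight_bounded w)
  (w_ge0 : weight_nonneg w) (w_sym : weight_symmetric w x)
  (solx : is_solution w x).

Local Notation U := (uniform_prob (@ltr01 R)).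
(** Negative times are frozen at time 0, so that monotonicity holds over all real times, as
    [monotone_functionals_limit] asks. *)
Let y (t a : R) : R := x (Num.max 0 t) (clamp 0 1 a).

Let max0 (t : R) : 0 <= Num.max 0 t :> R. Proof. by rewrite le_max lexx. Qed.

Let measurable_y t : @measurable_fun _ _ (measurableTypeR R) R setT (y t).
Proof. exact: (measurable_agent solx (max0 t)). Qed.

Let Y t : {RV U >-> R} :=
  @mfun_Sub _ _ (measurableTypeR R) R _ (mem_set (measurable_y t)).

Let y_bounded t : exists M : R, forall a, `|y t a| <= M.
Proof.
have [M xM] := solution_bounded solx (max0 t).
exists M => a; apply: xM; exists (Num.max 0 t), (clamp 0 1 a); split => //.
  by rewrite in_itv/= max0 lexx.
by rewrite in_itv/= clamp_itv.
Qed.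

Let convex_le (f f1 : R -> R) (s t : R) :
  (forall y : R, is_derive y 1 f (f1 y)) -> {homo f1 : y z / y <= z} -> s <= t ->
  \int[U]_a f (y t a) <= \int[U]_a f (y s a).
Proof.
move=> df nf1 st; have : Num.max 0 s <= Num.max 0 t.
  by rewrite ge_max max0 le_max st orbT.
rewrite /y le_eqVlt => /predU1P[->//|st'].
exact: (solution_convex_le mw bw w_ge0 w_sym solx (max0 s) st' df nf1).
Qed.

Let y0_itv a : 0 <= y 0 a <= 1.
Proof.
have := solution_init solx (_ : clamp 0 1 a \in `[0, 1]).
by rewrite /y maxxx !in_itv/=; apply; rewrite clamp_itv.
Qed.

(** Initial opinions lie in [[0, 1]], where [g] is nonpositive, so the integral at time 0 vanishes
    and the one at [t] is at most 0. The bound [K] secures integrability. *)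
Let ae_le0 (g : R -> R) (t : R) : 0 <= t -> measurable_fun setT g ->
  (forall M : R, exists K : R, forall z : R, `|z| <= M -> `|g z| <= K) ->
  (forall z : R, 0 <= z <= 1 -> g z <= 0) ->
  \int[U]_a sqr_pos (g (y t a)) <= \int[U]_a sqr_pos (g (y 0 a)) ->
  {ae U, forall a, g (y t a) <= 0}.
Proof.
move=> t0 mg gK g01 int_le; have [M yM] := y_bounded t; have [K MK] := gK M.
apply: (@Rintegral_sqr_pos_le0 _ _ _ _ _ K).
- exact: measurableT_comp mg (measurable_y t).
- by move=> a; exact: MK.
- apply: le_trans int_le _; rewrite (@eq_Rintegral _ _ _ U _ (cst 0)).
    by rewrite Rintegral_cst// mul0r.
  by move=> a _; rewrite /sqr_pos (max_idPl _) ?expr0n//; exact: g01.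
Qed.

Let y_itv (t : R) : U (y t @^-1` `[0, 1]) = 1%E.
Proof.
wlog t0 : t / 0 <= t.
  move=> H; have [/H//|/ltW t0] := leP 0 t.
  by have := H 0 (lexx _); rewrite /y maxxx (max_idPl t0).
have nfB : {homo (fun z => - (2 * Num.max 0 (0 - z))) : u v / u <= v :> R}.
  move=> u v uv; rewrite lerN2 ler_pM2l//.
  by have [?|?] := leP 0 (0 - u); have [?|?] := leP 0 (0 - v); lra.
have nfBr : {homo (fun z => 2 * Num.max 0 (z - 1)) : u v / u <= v :> R}.
  move=> u v uv; rewrite ler_pM2l//.
  by have [?|?] := leP 0 (u - 1); have [?|?] := leP 0 (v - 1); lra.
have low : {ae U, forall a, 0 - y t a <= 0}.
  apply: (ae_le0 (g := fun z => 0 - z)) => //.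
  - exact: measurable_funB.
  - by move=> M; exists M => z; rewrite sub0r normrN.
  - by move=> z /andP[z0 _]; rewrite subr_le0.
  - exact: convex_le (is_derive_sqr_posB 0) nfB t0.
have high : {ae U, forall a, y t a - 1 <= 0}.
  apply: (ae_le0 (g := fun z => z - 1)) => //.
  - exact: measurable_funB.
  - by move=> M; exists (M + 1) => z zM; rewrite (le_trans (ler_normB _ _))// normr1 lerD2r.
  - by move=> z /andP[_ z1]; rewrite subr_le0.
  - exact: convex_le (is_derive_sqr_posBr 1) nfBr t0.
have mpre : measurable (y t @^-1` `[0, 1]).
  by rewrite -[X in measurable X]setTI; exact: measurable_y.
have : U (~` (y t @^-1` `[0, 1])) = 0%E.
  apply/negligibleP; first exact: measurableC.
  apply: negligibleS (negligibleU low high) => a /= Na; apply/not_andP => -[].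
  by rewrite !subr_le0 => y0 y1; apply: Na; rewrite in_itv/= y0 y1.
rewrite probability_setC// => /eqP.
by rewrite sube_eq ?add0e ?fin_num_measure// => /eqP <-.
Qed.

Lemma opinion_distribution_limit :
  exists mu_oo : {measure set R -> \bar R}, mu_oo (~` `[0, 1]) = 0%E /\
    converges_in_distribution (opinion_distribution x) mu_oo.
Proof.
have [|c s t st|mu_oo [mu01 cvmu]] := @monotone_functionals_limit _ _ R U Y y_itv.
- exact: y_bounded.
- apply: convex_le (is_derive_sqr_posB c) _ st.
  move=> u v uv; rewrite lerN2 ler_pM2l//.
  by have [?|?] := leP 0 (c - u); have [?|?] := leP 0 (c - v); lra.
exists mu_oo; split => // A mA A0.
(* The law of [Y t] is the opinion distribution as soon as [0 <= t], hence eventually. *)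
apply: cvg_trans (cvmu A mA A0); apply: near_eq_cvg; near=> t.
have t0 : 0 <= t by near: t; apply: nbhs_pinfty_ge; exact: num_real.
have mpre : measurable (y t @^-1` A).
  by rewrite -[X in measurable X]setTI; exact: measurable_y.
rewrite -[LHS]/(U (y t @^-1` A)) [LHS]uniform01E// /opinion_distribution.
congr lebesgue_measure; apply/seteqP; split => a /=.
  by move=> [Aa a01]; split => //; move: Aa; rewrite /y (max_idPr t0) clamp_id// -in_itv.
by move=> [a01 Aa]; split => //; rewrite /y (max_idPr t0) clamp_id// -in_itv.
Unshelve. all: by end_near. Qed.

End opinion.

Unset Implicit Arguments.
Set Strict Implicit.

(* A measure on [0, 1] is a Borel measure on R that vanishes outside [0, 1]. *)
Theorem theorem1p1 (R : realType) (w : R -> R -> R -> R -> R -> R)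
    (x : R -> R -> R) :
  weight_measurable w -> weight_bounded w ->
  weight_nonneg w -> weight_symmetric w x ->
  is_solution w x ->
  exists mu_oo : {measure set R -> \bar R},
    mu_oo (~` `[0, 1]) = 0%E /\
    converges_in_distribution (opinion_distribution x) mu_oo.
Proof.
move=> mw bw w_ge0 w_sym solx.
exact: opinion_distribution_limit mw bw w_ge0 w_sym solx.
Qed.
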